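(* Let $n_e \ge 1$ and $T \ge 1$ be integers, let $\gamma \in [0,1]$, let $A \in \mathbb{R}^{n_e \times n_e}$ be the matrix all of whose entries equal $\frac{1}{n_e}$, and let $B \in \mathbb{R}^{n_e \times n_e}$ be any left stochastic matrix. Let $Q, Q_f, R \in \mathbb{R}^{n_e \times n_e}$ be positive semidefinite, let $\mathbf{x}_0 \in \Delta$ be a given initial state, and consider the control problem $$\underset{\mathbf{u}_t,\ t=0,\dots,T-1}{\text{minimize}} \quad \sum_{t=0}^{T-1}\left(\mathbf{x}_t^\top Q \mathbf{x}_t + \mathbf{u}_t^\top R \mathbf{u}_t\right) + \mathbf{x}_T^\top Q_f \mathbf{x}_T$$ subject to $\mathbf{x}_{t+1} = \gamma A \mathbf{x}_t + (1-\gamma) B \mathbf{u}_t$ for $t = 0, \dots, T-1$, $\mathbf{x}_t \in \Delta$ for $t = 0, \dots, T$, and $\mathbf{u}_t \in \Delta$ for $t = 0, \dots, T-1$. Then the set of optimal controls is described as follows: for each $t = 0, \dots, T-2$, the set of optimal $\mathbf{u}_t$ is the solution set of $$\underset{\mathbf{u} \in \Delta}{\text{minimize}} \quad \left(\tfrac{\gamma}{n_e}\mathbb{I} + (1-\gamma)B\mathbf{u}\right)^\top Q \left(\tfrac{\gamma}{n_e}\mathbb{I} + (1-\gamma)B\mathbf{u}\right) + \mathbf{u}^\top R \mathbf{u},$$ and the set of optimal $\mathbf{u}_{T-1}$ is the solution set of $$\underset{\mathbf{u} \in \Delta}{\text{minimize}} \quad \left(\tfrac{\gamma}{n_e}\mathbb{I}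 + (1-\gamma)B\mathbf{u}\right)^\top Q_f \left(\tfrac{\gamma}{n_e}\mathbb{I} + (1-\gamma)B\mathbf{u}\right) + \mathbf{u}^\top R \mathbf{u}.$$ That is, $(\mathbf{u}_0, \dots, \mathbf{u}_{T-1})$ is optimal for the control problem if and only if each $\mathbf{u}_t$ with $0 \le t \le T-2$ is a minimizer of the first problem and $\mathbf{u}_{T-1}$ is a minimizer of the second. Here $\mathbb{I} = (1,1,\dots,1)^\top \in \mathbb{R}^{n_e}$.
   Context: $\Delta = \{ f \in \mathbb{R}^{n_e} : \sum_{i=1}^{n_e} f_i = 1,\ f_i \ge 0 \text{ for all } i \}$ is the probability simplex in $\mathbb{R}^{n_e}$. A matrix in $\mathbb{R}^{n_e \times n_e}$ is called left stochastic if each of its columns belongs to $\Delta$. *)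

(* Defs.v *)
From HB Require Import structures.
From mathcomp Require Import all_boot all_order all_algebra.
From mathcomp Require Import all_classical all_reals.

Set Implicit Arguments.
Unset Strict Implicit.
Unset Printing Implicit Defensive.

Import Order.TTheory GRing.Theory Num.Theory.
Local Open Scope classical_set_scope.
Local Open Scope ring_scope.

Section Definitions.
Context {R : realType}.

Definition argmin {V : Type} (D : set V) (f : V -> R) : set V :=
  [set u | D u /\ forall v, D v -> f u <= f v].

Section Matrices.
Context {n : nat}.

Definition simplex : set 'cV[R]_n :=
  [set f | \sum_(i < n) f i 0 = 1 /\ forall i, 0 <= f i 0].

Definition left_stochastic (B : 'M[R]_n) : Prop :=
  forall j, simplex (col j B).

Definition qform (M : 'M[R]_n) (x : 'cV[R]_n) : R := (x^T *m M *m x) 0 0.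

Definition psd (M : 'M[R]_n) : Prop :=
  M^T = M /\ forall x, 0 <= qform M x.

Definition uniform_mx : 'M[R]_n := const_mx n%:R^-1.

Definition ones : 'cV[R]_n := const_mx 1.

Definition stage_cost (gamma : R) (B M Rm : 'M[R]_n) (u : 'cV[R]_n) : R :=
  qform M ((gamma / n%:R) *: ones + (1 - gamma) *: (B *m u)) + qform Rm u.

Section ControlProblem.
Context {T : nat}.

(* For t : 'I_T, the times t and t + 1 are, as elements of 'I_T.+1,
   widen_ord (leqnSn T) t and lift ord0 t. *)
Definition feasible (gamma : R) (A B : 'M[R]_n) (x0 : 'cV[R]_n) :
    set (('I_T.+1 -> 'cV[R]_n) * ('I_T -> 'cV[R]_n)) :=
  [set xu | [/\ xu.1 ord0 = x0,
    forall t : 'I_T, xu.1 (lift ord0 t) =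
      gamma *: (A *m xu.1 (widen_ord (leqnSn T) t))
      + (1 - gamma) *: (B *m xu.2 t),
    forall t : 'I_T.+1, simplex (xu.1 t)
    & forall t : 'I_T, simplex (xu.2 t)]].

Definition total_cost (Q Qf Rm : 'M[R]_n)
    (xu : ('I_T.+1 -> 'cV[R]_n) * ('I_T -> 'cV[R]_n)) : R :=
  \sum_(t < T) (qform Q (xu.1 (widen_ord (leqnSn T) t)) + qform Rm (xu.2 t))
  + qform Qf (xu.1 ord_max).

Definition optimal_controls (gamma : R) (A B Q Qf Rm : 'M[R]_n)
    (x0 : 'cV[R]_n) : set ('I_T -> 'cV[R]_n) :=
  [set xu.2 | xu in argmin (feasible gamma A B x0) (total_cost Q Qf Rm)].

End ControlProblem.
End Matrices.
End Definitions.

(* Main.v *)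
Require Import Defs.
From HB Require Import structures.
From mathcomp Require Import all_boot all_order all_algebra.
From mathcomp Require Import all_classical all_reals.
From mathcomp Require Import topology normedtype derive.

Set Implicit Arguments.
Unset Strict Implicit.
Unset Printing Implicit Defensive.

Import Order.TTheory GRing.Theory Num.Theory.
Import numFieldNormedType.Exports.
Local Open Scope classical_set_scope.
Local Open Scope ring_scope.

(** Every state lies in the simplex, so its entries sum to [1] and the averaging
    matrix sends it to [n^-1 *: ones]: the next state depends on the current
    control only.  After a shift of the time index the total cost is a constant
    plus a sum of stage costs, each depending on a single control, and a
    separable function is minimized coordinatewise.  That every minimizer of one
    stage extends to an optimal sequence of controls also requires the other
    stages to have minimizers, which they do because the simplex is compact. *)

Lemma argmin_sum (R : realType) (I : finType) (V : Type) (D : set V)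
    (f : I -> V -> R) :
  argmin [set u : I -> V | forall i, D (u i)] (fun u => \sum_i f i (u i)) =
  [set u | forall i, argmin D (f i) (u i)].
Proof.
apply/seteqP; split=> u /=; last first.
  move=> minu; split=> [i|v Dv]; first by case: (minu i).
  by apply: ler_sum => i _; case: (minu i) => _; apply.
move=> [Du minu] i; split=> // v Dv.
(* Changing only coordinate [i] leaves all other summands as they are, so they cancel from the
   comparison of the two sums. *)
pose w j := if j == i then v else u j.
have : \sum_j f j (u j) <= \sum_j f j (w j).
  by apply: minu => j; rewrite /w; case: eqP.
rewrite (bigD1 i) //= [leRHS](bigD1 i) //= {1}/w eqxx.
rewrite [X in _ <= _ + X](eq_bigr (fun j => f j (u j))) ?lerD2r // => j.
by rewrite /w => /negPf ->.
Qed.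

Section Simplex.
Context {R : realType} {n : nat}.
Implicit Types (M B : 'M[R]_n) (x u : 'cV[R]_n).

Lemma simplex_nonempty : (0 < n)%N -> @simplex R n !=set0.
Proof.
move=> n0; exists (delta_mx (Ordinal n0) 0); split=> [|i]; last first.
  by rewrite mxE ler0n.
rewrite (bigD1 (Ordinal n0)) //= mxE !eqxx big1 ?addr0 // => i /negPf ne.
by rewrite mxE ne.
Qed.

Lemma simplex_convex (a : R) x y : 0 <= a <= 1 ->
  simplex x -> simplex y -> simplex (a *: x + (1 - a) *: y).
Proof.
move=> /andP[a0 a1] [sx x0] [sy y0]; split=> [|i]; last first.
  by rewrite !mxE addr_ge0 ?mulr_ge0 ?subr_ge0.
under eq_bigr do rewrite !mxE.
by rewrite big_split /= -!mulr_sumr sx sy !mulr1 addrC subrK.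
Qed.

Lemma simplex_stochastic B x :
  left_stochastic B -> simplex x -> simplex (B *m x).
Proof.
move=> hB [sx x0]; split=> [|i]; last first.
  rewrite mxE sumr_ge0 // => j _; rewrite mulr_ge0 //.
  by have [_ /(_ i)] := hB j; rewrite mxE.
under eq_bigr do rewrite mxE.
(* After the exchange, the inner sums are the column sums of [B], all equal to 1. *)
rewrite exchange_big /= -[RHS]sx; apply: eq_bigr => j _.
rewrite -mulr_suml; have [+ _] := hB j.
by under eq_bigr do rewrite mxE; move=> ->; rewrite mul1r.
Qed.

Lemma uniform_left_stochastic : (0 < n)%N -> left_stochastic (@uniform_mx R n).
Proof.
move=> n0 j; split=> [|i]; last by rewrite !mxE invr_ge0 ler0n.
under eq_bigr do rewrite !mxE.
by rewrite sumr_const card_ord -[LHS]mulr_natl mulfV // pnatr_eq0 -lt0n.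
Qed.

Lemma uniform_mx_simplex x : simplex x -> uniform_mx *m x = n%:R^-1 *: ones.
Proof.
move=> [sx _]; apply/matrixP => i j; rewrite !mxE mulr1 ord1.
by under eq_bigr do rewrite mxE; rewrite -mulr_sumr sx mulr1.
Qed.

(** A closed subset of the compact cube $[0,1]^n$. Row vectors appear because [rV_compact] and
    [EVT_min_rV] are stated for them; minimizers are transposed back afterwards. *)
Lemma simplex_compact : compact [set w : 'rV[R]_n | simplex w^T].
Proof.
have cube : compact [set w : 'rV[R]_n | forall i, `[0, 1]%classic (w ord0 i)].
  by apply: (@rV_compact R n (fun=> `[0, 1]%classic)) => i;
    exact: segment_compact.
apply: subclosed_compact cube _.
(* Closedness: a hyperplane intersected with coordinate half-spaces, each the preimage of a closed
   set under a continuous map. *)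
- have -> : [set w : 'rV[R]_n | simplex w^T] =
      (fun w : 'rV[R]_n => \sum_i w 0 i) @^-1` [set s | s = 1] `&`
      \bigcap_(i in setT) ((fun w : 'rV[R]_n => w 0 i) @^-1` [set s | 0 <= s]).
    apply/seteqP; split=> w /=; rewrite /simplex /=.
      move=> [sw w0]; split=> [|i _]; last by have := w0 i; rewrite mxE.
      by rewrite -sw; apply: eq_bigr => i _; rewrite mxE.
    move=> [sw w0]; split=> [|i]; last by rewrite mxE; exact: w0.
    by rewrite -sw; apply: eq_bigr => i _; rewrite mxE.
  apply: closedI; last first.
    apply: closed_bigI => i _; apply: preimage_closed; last exact: closed_ge.
    by move=> w _; exact: coord_continuous.
  apply: preimage_closed; last exact: closed_eq.
  move=> w _; apply: continuous_big => [|i _]; first exact: add_continuous.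
  exact: coord_continuous.
(* An entry is at most 1 because the remaining entries are nonnegative and the total is 1. *)
move=> w [sw w0] i /=; rewrite in_itv /=.
have -> : w ord0 i = w^T i 0 by rewrite mxE.
by rewrite w0 -sw (bigD1 i) //= lerDl sumr_ge0.
Qed.

(** A quadratic form is a polynomial in the coordinates. Continuity is asked of the coordinates of
    [g] only, so that [g] can be the transposition of rows or an affine map composed with it. *)
Lemma continuous_qform (T : topologicalType) M (g : T -> 'cV[R]_n) :
  (forall i, continuous (fun w => g w i 0)) ->
  continuous (fun w => qform M (g w)).
Proof.
move=> cg.
have -> : (fun w => qform M (g w)) =
    fun w => \sum_j (\sum_i g w i 0 * M i j) * g w j 0.
  apply/funext => w; rewrite /qform mxE; apply: eq_bigr => j _; rewrite mxE.
  by congr (_ * _); apply: eq_bigr => i _; rewrite mxE.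
apply: continuous_big => [|j _ w]; first exact: add_continuous.
apply: cvgM; last exact: cg.
move: w; apply: continuous_big => [|i _ w]; first exact: add_continuous.
by apply: cvgM; [exact: cg|exact: cvg_cst].
Qed.

Lemma continuous_stage_cost (T : topologicalType) (gamma : R) B M Rm
    (g : T -> 'cV[R]_n) :
  (forall i, continuous (fun w => g w i 0)) ->
  continuous (fun w => stage_cost gamma B M Rm (g w)).
Proof.
move=> cg w; apply: cvgD; last exact: continuous_qform.
apply: (@continuous_qform _ M
  (fun w => (gamma / n%:R) *: ones + (1 - gamma) *: (B *m g w))) => i {}w.
under eq_fun do rewrite !mxE.
apply: cvgD; first exact: cvg_cst.
apply: cvgM; first exact: cvg_cst.
move: w; apply: continuous_big => [|j _ w]; first exact: add_continuous.
by apply: cvgM; [exact: cvg_cst|exact: cg].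
Qed.

Lemma argmin_stage_cost_nonempty (gamma : R) B M Rm : (0 < n)%N ->
  argmin simplex (stage_cost gamma B M Rm) !=set0.
Proof.
move=> /simplex_nonempty[u su].
have ctr i : continuous (fun w : 'rV[R]_n => w^T i 0).
  under eq_fun do rewrite mxE.
  exact: coord_continuous.
have [|w wS minw] := EVT_min_rV _ simplex_compact
    (continuous_subspaceT (@continuous_stage_cost _ gamma B M Rm _ ctr)).
  by exists u^T; rewrite /= trmxK.
exists w^T; split=> [|v sv]; first by rewrite inE in wS.
by rewrite -[v]trmxK; apply: minw; rewrite inE /= trmxK.
Qed.

End Simplex.

Section ControlProblem.
Context {R : realType} {n T : nat}.
Variables (gamma : R) (B Q Qf Rm : 'M[R]_n) (x0 : 'cV[R]_n).
Hypotheses (n_gt0 : (0 < n)%N) (gamma01 : 0 <= gamma <= 1).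
Hypotheses (stochB : left_stochastic B) (simplex_x0 : simplex x0).

Let next (u : 'cV[R]_n) : 'cV[R]_n :=
  (gamma / n%:R) *: ones + (1 - gamma) *: (B *m u).

(** No recursion on time is needed, since [next] ignores the current state: [unlift ord0] separates
    time 0 from the times [t + 1]. *)
Let trajectory (u : 'I_T -> 'cV[R]_n) (s : 'I_T.+1) : 'cV[R]_n :=
  if unlift ord0 s is Some t then next (u t) else x0.

(** The control at time [t] is charged for the state it produces, at time [t + 1]; that state is the
    final one when [t.+1 = T]. *)
Definition stage_weight (t : 'I_T) : 'M[R]_n := if (t.+1 < T)%N then Q else Qf.

Lemma next_stateE x u : simplex x ->
  gamma *: (uniform_mx *m x) + (1 - gamma) *: (B *m u) = next u.
Proof. by move=> sx; rewrite uniform_mx_simplex // scalerA. Qed.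

Lemma simplex_next u : simplex u -> simplex (next u).
Proof.
(* Any point of the simplex can serve as the current state; with [x0], [next u] becomes a convex
   combination of two points of the simplex. *)
move=> su; rewrite -(next_stateE _ simplex_x0).
apply: simplex_convex => //; apply: simplex_stochastic => //.
exact: uniform_left_stochastic.
Qed.

Lemma feasible_trajectory (u : 'I_T -> 'cV[R]_n) : (forall t, simplex (u t)) ->
  feasible gamma uniform_mx B x0 (trajectory u, u).
Proof.
move=> su.
have st s : simplex (trajectory u s).
  by rewrite /trajectory; case: unliftP => // t _; exact: simplex_next.
split=> //= [|t]; first by rewrite /trajectory unlift_none.
by rewrite next_stateE // /trajectory liftK.
Qed.

Lemma total_cost_separable x (u : 'I_T -> 'cV[R]_n) : (0 < T)%N ->
  feasible gamma uniform_mx B x0 (x, u) ->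
  total_cost Q Qf Rm (x, u) =
  qform Q x0 + \sum_t stage_cost gamma B (stage_weight t) Rm (u t).
Proof.
move=> T_gt0 [/= xx0 dyn sx _]; rewrite /total_cost /= big_split /=.
have xS t : x (lift ord0 t) = next (u t) by rewrite dyn next_stateE.
rewrite /stage_cost big_split /= addrAC addrA; congr (_ + _).
rewrite /stage_weight.
case: T T_gt0 u x xx0 xS {dyn sx} => // k _ u x xx0 xS.
(* The sum of state costs gives up its first term, at [x0], and the sum over controls its last,
   weighted by [Qf]. The [k] remaining terms match at times 1 to [k]. *)
rewrite big_ord_recl big_ord_recr /= ltnn -addrA -xx0.
congr (qform Q (x _) + _); first exact: val_inj.
congr (_ + _); last first.
  by rewrite -[X in _ = qform _ X]xS; congr (qform Qf (x _)); exact: val_inj.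
apply: eq_bigr => i _; rewrite ltnS ltn_ord -[X in _ = qform _ X]xS.
by congr (qform Q (x _)); exact: val_inj.
Qed.

(** The state constraints cost nothing: every choice of controls in the simplex has a feasible
    trajectory, and the cost of a feasible pair depends on its controls alone. Up to the constant
    [qform Q x0], this is the separable problem of [argmin_sum]. *)
Lemma optimal_controlsE : (0 < T)%N ->
  optimal_controls gamma uniform_mx B Q Qf Rm x0 =
  [set u : 'I_T -> 'cV[R]_n | forall t,
    argmin simplex (stage_cost gamma B (stage_weight t) Rm) (u t)].
Proof.
move=> T_gt0; rewrite -argmin_sum; apply/seteqP; split=> u.
  move=> [[x u'] [feas minx] /= <-]; split=> [|v sv]; first by case: feas.
  have feasv := feasible_trajectory sv.
  by have := minx _ feasv; rewrite !total_cost_separable // lerD2l.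
move=> [su minu]; have feasu := feasible_trajectory su.
exists (trajectory u, u) => //; split=> // -[x v] feas.
by rewrite !total_cost_separable // lerD2l; apply: minu; case: feas.
Qed.

Lemma optimal_control_values (t : 'I_T) :
  [set u t | u in optimal_controls gamma uniform_mx B Q Qf Rm x0] =
  argmin simplex (stage_cost gamma B (stage_weight t) Rm).
Proof.
have T_gt0 : (0 < T)%N by case: t => m; exact: leq_ltn_trans.
rewrite optimal_controlsE //; apply/seteqP; split=> [_ [u minu <-]//|v minv].
(* A minimizer for every stage at once; the value at [t] is then replaced by [v]. *)
have /choice[w minw] (s : 'I_T) :=
  argmin_stage_cost_nonempty gamma B (stage_weight s) Rm n_gt0.
exists (fun s => if s == t then v else w s); last by rewrite eqxx.
by move=> s; case: eqP => [->|].
Qed.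

End ControlProblem.

Theorem mainTheorem3 (R : realType) (n T : nat) (hn : (1 <= n)%N)
    (hT : (1 <= T)%N) (gamma : R) (hgamma : 0 <= gamma <= 1)
    (B : 'M[R]_n) (hB : left_stochastic B) (Q Qf Rm : 'M[R]_n)
    (hQ : psd Q) (hQf : psd Qf) (hRm : psd Rm)
    (x0 : 'cV[R]_n) (hx0 : simplex x0) :
  (forall u : 'I_T -> 'cV[R]_n,
     optimal_controls gamma uniform_mx B Q Qf Rm x0 u <->
     (forall t : 'I_T, (t.+1 < T)%N ->
        argmin simplex (stage_cost gamma B Q Rm) (u t)) /\
     (forall t : 'I_T, t.+1 = T ->
        argmin simplex (stage_cost gamma B Qf Rm) (u t))) /\
  (forall t : 'I_T, (t.+1 < T)%N ->
     [set u t | u in optimal_controls gamma uniform_mx B Q Qf Rm x0] =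
     argmin simplex (stage_cost gamma B Q Rm)) /\
  (forall t : 'I_T, t.+1 = T ->
     [set u t | u in optimal_controls gamma uniform_mx B Q Qf Rm x0] =
     argmin simplex (stage_cost gamma B Qf Rm)).
Proof.
have last_weight (t : 'I_T) : t.+1 = T -> stage_weight Q Qf t = Qf.
  by rewrite /stage_weight => ->; rewrite ltnn.
have inner_weight (t : 'I_T) : (t.+1 < T)%N -> stage_weight Q Qf t = Q.
  by rewrite /stage_weight => ->.
split=> [u|]; last first.
  split=> t tT; rewrite optimal_control_values //.
    by rewrite inner_weight.
  by rewrite last_weight.
rewrite optimal_controlsE //=; split=> [minu|[minQ minQf] t].
  split=> t tT; have := minu t.
    by rewrite inner_weight.
  by rewrite last_weight.
have := ltn_ord t; rewrite leq_eqVlt => /orP[/eqP tT|tT].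
  by rewrite last_weight //; exact: minQf.
by rewrite inner_weight //; exact: minQ.
Qed.
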